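(* (i) Let $\{S_i\}_{i=1}^m$ be an IFS of similitudes $S_i(x)=rR_ix+d_i$ on $\mathbb R^d$ with common ratio $r\in(0,1)$ and self-similar set $K$. Suppose its augmented tree $(X,\mathcal E)$ is simple, the corresponding incidence matrix $A$ is primitive (i.e. $A^n>0$ entrywise for some $n>0$), and the IFS satisfies condition (H). Then $K$ is Lipschitz equivalent to a dust-like self-similar set. (ii) If $K$ and $K'$ are self-similar sets of two IFSs each satisfying all the hypotheses in (i), and the two IFSs have the same number $m$ of similitudes and the same contraction ratio $r$, then $K$ and $K'$ are Lipschitz equivalent.
   Context: IFS: $S_i(x)=rR_ix+d_i$, $i=1,\dots,m$, with $0<r<1$, $R_i$ orthogonal, $d_i\in\mathbb R^d$; $K$ is the nonempty compact set with $K=\bigcup_iS_i(K)$, and is called a self-similar set. It is dust-like if $S_i(K)\cap S_j(K)=\emptyset$ for $i\ne j$. (The dust-like set is the attractor of such an IFS on some Euclidean space.) $\Sigma=\{1,\dots,m\}$, $X=\bigcup_{n\ge0}\Sigma^n$ with $\Sigma^0=\{o\}$ (empty word); $S_{\mathbf u}=S_{i_1}\circ\cdots\circ S_{i_n}$ and $K_{\mathbf u}=S_{\mathbf u}(K)$ for $\mathbf u=i_1\cdots i_n$. Condition (H): there is $c>0$ such that for all $n\ge1$ and $\mathbf u,\mathbf v\in\Sigma^n$, $K_{\mathbf u}\cap K_{\mathbf v}=\emptyset$ implies $\mathrm{dist}(K_{\mathbf u},K_{\mathbf v})\ge cr^n$. Augmented tree: $\mathcal E_v$ is the set of (vertical)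 edges joining $\mathbf u$ and $\mathbf ui$; $\mathcal E_h$ (horizontal edges) is the set of pairs $(\mathbf u,\mathbf v)$, $\mathbf u\neq\mathbf v$ in the same level $\Sigma^n$, with $K_{\mathbf u}\cap K_{\mathbf v}\neq\emptyset$. $\mathcal E=\mathcal E_v\cup\mathcal E_h$. Simple: a horizontal connected component is a maximal connected horizontal subgraph $T$ of some level $\Sigma^n$. $T\Sigma=\{\mathbf ui:\mathbf u\in T,i\in\Sigma\}$. Components $T,T'$ are equivalent if there is a bijection $g:T\cup T\Sigma\to T'\cup T'\Sigma$ (as subgraphs of $X$) such that $g,g^{-1}$ preserve vertical and horizontal edges; $[T]$ is the class of $T$. $X$ is simple if there are finitely many classes $\mathscr T_1,\dots,\mathscr T_\kappa$. Incidence matrix: $A=[a_{ij}]_{\kappa\times\kappa}$, where, for any component $T$ with $[T]=\mathscr T_i$, $a_{ij}$ is the number of horizontal connected components $Z$ of $T\Sigma$ with $[Z]=\mathscr T_j$ (this number being independent of the choice of $T$ in the class). Lipschitz equivalence: existence of a bijection $\sigma$ and $C>0$ with $C^{-1}|x-y|\le|\sigma(x)-\sigma(y)|\le C|x-y|$ for all $x,y$. *)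

(* Defs.v *)
From HB Require Import structures.
From mathcomp Require Import all_boot all_order all_algebra.
From mathcomp Require Import boolp classical_sets functions cardinality reals.
From mathcomp Require Import topology normedtype.
From Stdlib Require Import Relation_Operators.

Set Implicit Arguments.
Unset Strict Implicit.
Unset Printing Implicit Defensive.
Import Order.TTheory GRing.Theory Num.Theory.
Import numFieldNormedType.Exports.
Local Open Scope classical_set_scope.
Local Open Scope card_scope.
Local Open Scope ring_scope.

Section Euclidean.
Variables (R : realType).

(* The library norm on matrices is the sup norm, hence this definition.  The
   topology on 'cV[R]_d is nevertheless the Euclidean one. *)
Definition enorm d (x : 'cV[R]_d) : R := Num.sqrt (\sum_i x i 0 ^+ 2).

(* Real-valued infimum: meaningful for nonempty A and B. *)
Definition euclid_dist d (A B : set 'cV[R]_d) : R :=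
  inf [set enorm (x - y) | x in A & y in B].

Definition lipschitz_equivalent d d' (A : set 'cV[R]_d) (B : set 'cV[R]_d') :=
  exists sigma : 'cV[R]_d -> 'cV[R]_d', set_bij A B sigma /\
    exists2 C : R, 0 < C & forall x y, A x -> A y ->
      C^-1 * enorm (x - y) <= enorm (sigma x - sigma y) <= C * enorm (x - y).

Record ifs (d m : nat) := IFS {
  ifs_ratio : R;
  ifs_rot : 'I_m -> 'M[R]_d;
  ifs_trans : 'I_m -> 'cV[R]_d;
  ifs_ratio_bounds : 0 < ifs_ratio < 1;
  ifs_rot_orthogonal : forall i, (ifs_rot i)^T *m ifs_rot i = 1%:M }.

End Euclidean.

Section IteratedFunctionSystem.
Variables (R : realType) (d m : nat) (S : ifs R d m).

Definition ifs_map (i : 'I_m) (x : 'cV[R]_d) : 'cV[R]_d :=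
  ifs_ratio S *: (ifs_rot S i *m x) + ifs_trans S i.

Definition self_similar_set (K : set 'cV[R]_d) : Prop :=
  [/\ K !=set0, compact K & K = \bigcup_i (ifs_map i @` K)].

Definition dust_like (K : set 'cV[R]_d) : Prop :=
  forall i j, i != j -> (ifs_map i @` K) `&` (ifs_map j @` K) = set0.

Definition word := seq 'I_m.

Definition word_map (u : word) (x : 'cV[R]_d) : 'cV[R]_d :=
  foldr ifs_map x u.

Variable K : set 'cV[R]_d.

Definition cell (u : word) : set 'cV[R]_d := word_map u @` K.

Definition condition_H : Prop :=
  exists2 c : R, 0 < c & forall (n : nat) (u v : word),
    (0 < n)%N -> size u = n -> size v = n -> cell u `&` cell v = set0 ->
    c * ifs_ratio S ^+ n <= euclid_dist (cell u) (cell v).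

(* Both edge relations are undirected. *)
Definition vedge (u v : word) : Prop :=
  exists i : 'I_m, v = rcons u i \/ u = rcons v i.

Definition hedge (u v : word) : Prop :=
  [/\ u <> v, size u = size v & cell u `&` cell v !=set0].

Definition hconnected (T : set word) : Prop :=
  T !=set0 /\ forall u v, T u -> T v ->
    clos_refl_trans word (fun x y => [/\ T x, T y & hedge x y]) u v.

Definition hcomponent (T : set word) : Prop :=
  exists n : nat, [/\ T `<=` [set u | size u = n], hconnected T &
    forall T' : set word, T' `<=` [set u | size u = n] -> hconnected T' ->
      T `<=` T' -> T' = T].

Definition children (T : set word) : set word :=
  [set rcons u i | u in T & i in [set: 'I_m]].

Definition hequiv (T T' : set word) : Prop :=
  exists g : word -> word,
    set_bij (T `|` children T) (T' `|` children T') g /\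
    forall u v, (T `|` children T) u -> (T `|` children T) v ->
      (vedge u v <-> vedge (g u) (g v)) /\ (hedge u v <-> hedge (g u) (g v)).

Definition hclass (T : set word) : set (set word) :=
  [set T' | hcomponent T' /\ hequiv T T'].

Definition hclasses : set (set (set word)) := hclass @` hcomponent.

Definition simple_tree : Prop := finite_set hclasses.

(* The count is required to be the same for every T in the class: this is what
   makes the entry A i j well defined. *)
Definition incidence_matrix kappa (cl : 'I_kappa -> set (set word))
    (A : 'M[nat]_kappa) : Prop :=
  forall (i j : 'I_kappa) (T : set word), hcomponent T -> hclass T = cl i ->
    [set Z | [/\ hcomponent Z, Z `<=` children T & hclass Z = cl j]]
      #= `I_(A i j).

End IteratedFunctionSystem.

Definition primitive_mx kappa (A : 'M[nat]_kappa) : Prop :=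
  exists2 n : nat, (0 < n)%N & forall i j, (0 < (A ^+ n) i j)%N.

(* The enumeration cl of the classes is immaterial: another one conjugates A by
   a permutation matrix, which preserves primitivity. *)
Definition simple_primitive_H (R : realType) d m (S : ifs R d m)
    (K : set 'cV[R]_d) : Prop :=
  [/\ simple_tree S K,
      exists (kappa : nat) (cl : 'I_kappa -> set (set (word m)))
             (A : 'M[nat]_kappa),
        [/\ set_bij [set: 'I_kappa] (hclasses S K) cl,
            incidence_matrix S K cl A & primitive_mx A] &
      condition_H S K].

(* Main.v *)
Require Import Defs.
From mathcomp Require Import all_boot all_order all_algebra.
From mathcomp Require Import boolp classical_sets functions cardinality reals.
From mathcomp Require Import topology normedtype sequences.
From mathcomp Require Import zify lra.
From Stdlib Require Import Relation_Operators.

(** Both parts reduce to one fact: for every large [N], the attractor [K] is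
    bi-Lipschitz to the space of sequences over [m ^ N] letters in which two
    sequences that first differ at index [k] are at distance [r ^ (N k)]
    ([attractor_coding]). The model depends on [m], [r] and [N] alone, so two
    attractors with the same [m] and [r] share it, which is (ii). For (i) take
    [N] so large that [r ^ N <= 1/3]: then the maps [x |-> r ^ N x + e_i], one for
    each basis vector of [R ^ (m ^ N)], have a dust-like attractor, and it is
    bi-Lipschitz to the same model ([corner_coding]).

    The components of the levels of the augmented tree form a tree whose
    boundary is [K]. Components have bounded size, as there are finitely many
    classes and the size depends on the class only ([component_bounded]), so a
    component of level [n] spans a set of diameter at most a multiple of
    [r ^ n] ([component_diameter]), while condition (H) keeps distinct components
    of level [n] at least a multiple of [r ^ n] apart ([component_separation]).
    Hence only the combinatorial tree of components matters, and it has to be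
    compared with the regular [m ^ N]-ary tree.

    A component [T] of level [n] has [|T| m ^ N] descendants of level [n + N],
    grouped into components. If these components can be dealt out to the
    members of [T] so that each member receives exactly [m ^ N] words, then the
    words of the levels [0, N, 2N, ...] become a regular tree in which words of
    a common component have a common parent, and this tree codes [K]
    ([regular_tree]). Dealing out is possible as soon as there are enough
    singleton components among the descendants: the larger components are placed
    first, with room to spare, and the singletons fill the remaining places
    ([distribute_classes]). Primitivity supplies the singletons: the component of
    the empty word is a singleton, so its class, whose members are singletons,
    occurs a fixed number of levels below every component
    ([singleton_descendant], [many_singletons]). *)

Set Implicit Arguments.
Unset Strict Implicit.
Unset Printing Implicit Defensive.
Import Order.TTheory GRing.Theory Num.Theory.
Import numFieldNormedType.Exports.
Local Open Scope classical_set_scope.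
Local Open Scope ring_scope.

(** * Dealing out classes of an equivalence relation *)

Section Words.
Context {m : nat}.
Local Open Scope nat_scope.

Definition words (n : nat) : seq (word m) := [seq val t | t <- enum {: n.-tuple 'I_m}].

Lemma mem_words n (u : word m) : (u \in words n) = (size u == n).
Proof.
apply/mapP/idP => [[t _ ->]|un]; first by rewrite size_tuple.
by exists (Tuple un) => //; rewrite mem_enum.
Qed.

Lemma uniq_words n : uniq (words n).
Proof. by rewrite map_inj_uniq ?enum_uniq //; apply: val_inj. Qed.

Lemma size_words n : size (words n) = m ^ n.
Proof. by rewrite size_map -cardE card_tuple card_ord. Qed.

End Words.

Lemma pigeonhole_capacity (J : eqType) (js : seq J) (c : J -> nat) (w : nat) :
  (forall j, j \in js -> c j < w)%N ->
  (\sum_(j <- js) c j + size js <= size js * w)%N.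
Proof.
elim: js => [|j js IH] cw; first by rewrite big_nil.
rewrite big_cons /=; have := cw j (mem_head _ _).
have := IH (fun i ij => cw i (mem_behead (s := j :: js) ij)).
by lia.
Qed.

Section Equivalence.
Context {X : eqType} {e : rel X}.
Hypothesis e_equiv : equivalence_rel e.

Lemma equivalence_refl x : e x x. Proof. by case: (e_equiv x x x). Qed.

Lemma equivalence_eql x y z : e x y -> e x z = e y z.
Proof. by case: (e_equiv x y z) => _; apply. Qed.

Lemma equivalence_sym x y : e x y = e y x.
Proof.
by apply/idP/idP => xy; rewrite -(equivalence_eql _ xy) equivalence_refl.
Qed.

End Equivalence.

Section Distribute.
Context {X J : eqType}.
Variables (e : rel X) (M : nat) (js : seq J).
Hypotheses (e_equiv : equivalence_rel e) (js_uniq : uniq js).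
Local Open Scope nat_scope.


Lemma count_class_remaining (D : seq X) x y : ~~ e x y ->
  count (e y) [seq z <- D | ~~ e x z] = count (e y) D.
Proof.
move=> nxy; rewrite count_filter; apply: eq_count => z /=.
case yz: (e y z) => //=; apply: contra nxy => xz.
by rewrite (equivalence_eql e_equiv _ xz) (equivalence_sym e_equiv).
Qed.

(** The receivers [j] have capacities [c j] adding up to the size of [D], and
    no class of [e] may be split. While nonsingleton classes remain, at least
    [size js * M] singletons are still to come, so the free places number as
    many and some receiver has [M] of them; afterwards any receiver that is not
    full will do. *)
Lemma distribute_classes (j0 : J) (D : seq X) (c : J -> nat) :
  \sum_(j <- js) c j = size D ->
  (forall x, x \in D -> count (e x) D <= M) ->
  size js * M <= count (fun x => count (e x) D == 1) D \/
    (forall x, x \in D -> count (e x) D = 1) ->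
  exists g : X -> J,
    [/\ forall x, x \in D -> g x \in js,
        forall x y, x \in D -> e x y -> g x = g y &
        forall j, j \in js -> count (fun x => g x == j) D = c j].
Proof.
have [n] := ubnP (size D); elim: n D c => // n IH D c sD sumc leM units.
case: (posnP (size D)) => [D0|D_gt0].
  exists (fun=> j0); move/size0nil: D0 sumc => -> /= sumc; split=> // j jjs.
  move/eqP: sumc; rewrite sum_nat_seq_eq0 => /allP /(_ j jjs) /= cj.
  by rewrite (eqP cj).
(* A class with two members or more is placed first if there is one; the
   singletons still to come then leave room for it in some receiver. *)
have [x [j [xD jjs cj units']]] : exists x j, [/\ x \in D, j \in js,
    count (e x) D <= c j &
    (1 < count (e x) D) \/ (forall x, x \in D -> count (e x) D = 1)].
  have pigeon w : size D + size js > size js * w -> exists2 j, j \in js & w <= c j.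
    move=> big; have [/hasP//|/hasPn no] := boolP (has (fun j => w <= c j) js).
    have cw j : j \in js -> c j < w by move=> /no; rewrite -ltnNge.
    by have := pigeonhole_capacity cw; rewrite sumc; lia.
  have js_gt0 : 0 < size js.
    by case: (js) sumc => // ; rewrite big_nil => D0; rewrite -D0 in D_gt0.
  have [/hasP [x xD x1]|/hasPn no] := boolP (has (fun x => 1 < count (e x) D) D).
    have [big|all1] := units; last by rewrite all1 in x1.
    have [|j jjs cj] := pigeon M.
      by have := leq_trans big (count_size _ _); lia.
    by exists x, j; split=> //; [apply: leq_trans (leM x xD) cj|left].
  have all1 x : x \in D -> count (e x) D = 1.
    move=> xD; apply/eqP; rewrite eqn_leq leqNgt no //= -has_count.
    by apply/hasP; exists x => //; apply: equivalence_refl.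
  have [|j jjs cj] := pigeon 1; first by lia.
  have [x xD] : exists x, x \in D.
    by case: (D) D_gt0 => // x *; exists x; rewrite mem_head.
  by exists x, j; split=> //; [rewrite all1|right].
set w := count (e x) D in cj units'.
set D' := [seq z <- D | ~~ e x z].
have sizeD : w + size D' = size D by rewrite size_filter count_predC.
have w_gt0 : 0 < w.
  by rewrite -has_count; apply/hasP; exists x => //; apply: equivalence_refl.
pose c' k := if k == j then c j - w else c k.
have sumc' : \sum_(k <- js) c' k = size D'.
  have := sumc; rewrite !(bigD1_seq j) //= /c' eqxx.
  under [X in _ = _ -> _ + X = _]eq_bigr => k kj do rewrite (negbTE kj).
  by lia.
have leM' y : y \in D' -> count (e y) D' <= M.
  rewrite mem_filter => /andP[nxy yD].
  by rewrite count_class_remaining //; apply: leM.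
have unitsD' : size js * M <= count (fun y => count (e y) D' == 1) D' \/
    (forall y, y \in D' -> count (e y) D' = 1).
  case: units' => [w1|all1]; last first.
    right=> y; rewrite mem_filter => /andP[nxy yD].
    by rewrite count_class_remaining ?all1.
  case: units => [big|all1]; last by rewrite /w all1 in w1.
  left; apply: leq_trans big _; rewrite count_filter leq_eqVlt; apply/orP; left.
  apply/eqP; apply: eq_count => y /=; case xy: (e x y) => /=.
    have -> : count (e y) D = w.
      by apply: eq_count => z; rewrite (equivalence_eql e_equiv _ xy).
    by rewrite andbF; apply/negbTE; rewrite gtn_eqF.
  by rewrite andbT count_class_remaining // xy.
have ltD'n : size D' < n by lia.
have [g [gjs gconst gcount]] := IH D' c' ltD'n sumc' leM' unitsD'.
exists (fun y => if e x y then j else g y); split.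
- move=> y yD; case: ifP => // nxy; apply: gjs.
  by rewrite mem_filter nxy.
- move=> y z yD yz.
  have -> : e x z = e x y.
    by rewrite !(equivalence_sym e_equiv x) (equivalence_eql e_equiv x yz).
  by case: ifP => // nxy; apply: gconst => //; rewrite mem_filter nxy.
- move=> k kjs.
  have <- : count (fun y => (if e x y then j else g y) == k) [seq z <- D | e x z] +
      count (fun y => (if e x y then j else g y) == k) D' =
      count (fun y => (if e x y then j else g y) == k) D.
    by rewrite -count_cat; apply/permP; rewrite perm_filterC.
  have -> : count (fun y => (if e x y then j else g y) == k) D' = c' k.
    rewrite -gcount //; apply: eq_in_count => y.
    by rewrite mem_filter => /andP[/negbTE -> _].
  rewrite (_ : count _ _ = (j == k) * w).
    by rewrite /c' (eq_sym k); case: eqVneq => [<-|]; lia.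
  rewrite count_filter /w; case: eqVneq => jk; rewrite ?mul1n ?mul0n.
    by apply: eq_count => y /=; case: (e x y); rewrite ?jk ?eqxx ?andbF.
  rewrite (eq_count (a2 := pred0)) ?count_pred0 // => y /=.
  by case: (e x y); rewrite ?andbF //= (negbTE jk).
Qed.

End Distribute.

(** * Regrouping the levels of a word tree into a regular tree *)

Section Regrouping.
Context {m : nat} (e : rel (word m)).
Hypotheses (e_equiv : equivalence_rel e)
  (e_size : forall u v, e u v -> size u = size v)
  (e_take : forall n u v, e u v -> e (take n u) (take n v)).
Local Open Scope nat_scope.

Definition class_words (u : word m) := [seq v <- words (size u) | e u v].

Definition descendants (N : nat) (u : word m) :=
  [seq a ++ b | a <- class_words u, b <- words N].

Lemma mem_class_words u v : (v \in class_words u) = e u v.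
Proof.
rewrite mem_filter mem_words andbC.
by case uv: (e u v); rewrite ?andbF // (e_size uv) eqxx.
Qed.

Lemma uniq_class_words u : uniq (class_words u).
Proof. exact/filter_uniq/uniq_words. Qed.

Lemma eq_class_words u v : e u v -> class_words u = class_words v.
Proof.
move=> uv; rewrite /class_words (e_size uv); apply: eq_filter => w.
exact: (equivalence_eql e_equiv).
Qed.

Lemma size_descendants N u :
  size (descendants N u) = size (class_words u) * m ^ N.
Proof. by rewrite size_allpairs size_words. Qed.

Lemma mem_descendants N u v :
  (v \in descendants N u) = (size v == size u + N) && e u (take (size u) v).
Proof.
apply/allpairsP/andP => [[[a b] /= []]|[/eqP sv uv]].
  rewrite mem_class_words mem_words => ua /eqP sb ->.
  by rewrite (e_size ua) size_cat sb eqxx take_size_cat.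
exists (take (size u) v, drop (size u) v) => /=.
by rewrite mem_class_words mem_words size_drop sv addKn eqxx cat_take_drop.
Qed.

Lemma uniq_descendants N u : uniq (descendants N u).
Proof.
apply: allpairs_uniq; [exact: uniq_class_words|exact: uniq_words|].
move=> [a b] [a' b'] /allpairsP[[? ?] /= [ua _ [-> ->]]].
move=> /allpairsP[[? ?] /= [ua' _ [-> ->]]] /eqP.
move: ua ua'; rewrite !mem_class_words => /e_size ua /e_size ua'.
by rewrite eqseq_cat -?ua // => /andP[/eqP -> /eqP ->].
Qed.

Lemma descendants_closed N u v w :
  v \in descendants N u -> e v w -> w \in descendants N u.
Proof.
rewrite !mem_descendants => /andP[/eqP sv uv] vw.
rewrite -(e_size vw) sv eqxx /=.
have := e_take (size u) vw; rewrite -(equivalence_eql e_equiv _ uv).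
by [].
Qed.

Lemma count_descendants N u v : v \in descendants N u ->
  count (e v) (descendants N u) = size (class_words v).
Proof.
move=> vD; rewrite -size_filter; apply/perm_size/uniq_perm.
- exact/filter_uniq/uniq_descendants.
- exact: uniq_class_words.
- move=> w; rewrite mem_filter mem_class_words andbC.
  by case vw: (e v w); rewrite ?andbF // (descendants_closed vD).
Qed.

Context {M n0 : nat}.
Hypotheses (class_le : forall u, size (class_words u) <= M)
  (class_single : forall u, exists v, [/\ size v = size u + n0,
     (forall w, e v w -> w = v) & e u (take (size u) v)]).

(** The [size (class_words u) * m ^ N1] words [N1] levels below the class of [u]
    fall into classes of at most [M] members, so there are at least
    [size (class_words u) * M] of these classes; each has a singleton [n0] levels
    below it, and these singletons are distinct. *)
Lemma many_singletons N1 u : M * M <= m ^ N1 ->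
  size (class_words u) * M <=
  count (fun x => count (e x) (descendants (N1 + n0) u) == 1)
    (descendants (N1 + n0) u).
Proof.
move=> leMN; set D := descendants _ _.
set U := [seq x <- D | count (e x) D == 1].
have sub : {subset descendants N1 u <=
    flatten [seq class_words (take (size u + N1) v) | v <- U]}.
  move=> a aD1; have := aD1; rewrite mem_descendants => /andP[/eqP sa ua].
  have [v [sv v1 av]] := class_single a; rewrite sa in sv av.
  have vD : v \in D.
    rewrite mem_descendants sv addnA eqxx /=.
    have := e_take (size u) av; rewrite take_takel ?leq_addr //.
    by rewrite -(equivalence_eql e_equiv _ ua).
  apply/flattenP; exists (class_words (take (size u + N1) v)); last first.
    by rewrite mem_class_words (equivalence_sym e_equiv).
  apply: map_f; rewrite mem_filter vD andbT count_descendants //.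
  rewrite (perm_size (s2 := [:: v])) //; apply: uniq_perm => //.
    exact: uniq_class_words.
  move=> w; rewrite mem_class_words inE.
  by apply/idP/eqP => [/v1|->] //; apply: equivalence_refl.
have := uniq_leq_size (uniq_descendants N1 u) sub.
rewrite size_descendants size_flatten sumnE !big_map => le1.
have le2 : \sum_(v <- U) size (class_words (take (size u + N1) v)) <= size U * M.
  elim: (U) => [|v U' IH]; first by rewrite big_nil.
  by rewrite big_cons /= mulSn leq_add.
have le3 := leq_trans le1 le2; rewrite -(size_filter _ D) -/U.
have [M0|M_gt0] := posnP M; first by rewrite M0 muln0.
have := leq_trans (leq_mul (leqnn (size (class_words u))) leMN) le3.
by rewrite mulnA leq_mul2r; case: M M_gt0.
Qed.

Context {N1 : nat}.
Hypothesis leMN : M * M <= m ^ N1.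
Let N := N1 + n0.

Lemma regroup_class u : exists g : word m -> word m,
  [/\ forall v, v \in descendants N u -> g v \in class_words u,
      forall v w, v \in descendants N u -> e v w -> g v = g w &
      forall w, w \in class_words u ->
        count (fun v => g v == w) (descendants N u) = m ^ N].
Proof.
apply: (distribute_classes e_equiv (M := M) (uniq_class_words u) [::]).
- by rewrite big_const_seq count_predT iter_addn_0 mulnC size_descendants.
- by move=> v vD; rewrite count_descendants.
- by left; apply: many_singletons.
Qed.

(** The parent assigned to [v] may differ from its ancestor [take n v], since a
    class of descendants can straddle several ancestors; it stays linked to it. *)
Lemma regroup : exists parent : word m -> word m, forall n v,
  [/\ size v = n + N -> e (take n v) (parent v),
      forall w, size v = n + N -> e v w -> parent v = parent w &
      size v = n ->
        size [seq w <- descendants N v | parent w == v] = m ^ N].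
Proof.
(* The dealing is chosen for the list [class_words u] and not for [u], so that
   all members of a class use the same one. *)
pose P (T : seq (word m)) (g : word m -> word m) := forall u, T = class_words u ->
  [/\ forall v, v \in descendants N u -> g v \in class_words u,
      forall v w, v \in descendants N u -> e v w -> g v = g w &
      forall w, w \in class_words u ->
        count (fun v => g v == w) (descendants N u) = m ^ N].
have /choice [G PG] : forall T, exists g, P T g.
  move=> T; have [[u ->]|no] := pselect (exists u, T = class_words u); last first.
    by exists id => u Tu; case: no; exists u.
  have [g [g1 g2 g3]] := regroup_class u; exists g => v uv.
  have sDv : descendants N u = descendants N v by rewrite /descendants uv.
  by rewrite -sDv -uv.
exists (fun v => G (class_words (take (size v - N) v)) v) => n v.
have tD w : size w = n + N -> w \in descendants N (take n w).
  by move=> sw; rewrite mem_descendants size_takel sw ?leq_addr // eqxx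
    equivalence_refl.
split=> [sv|w sv vw|sv].
- rewrite sv addnK; have [g1 _ _] := PG _ (take n v) erefl.
  by rewrite -mem_class_words; apply/g1/tD.
- rewrite -(e_size vw) sv addnK -(eq_class_words (e_take n vw)).
  by have [_ g2 _] := PG _ (take n v) erefl; apply: g2 vw; apply: tD.
- have [_ _ g3] := PG _ v erefl; rewrite -(g3 v) ?size_filter; last first.
    by rewrite mem_class_words equivalence_refl.
  apply: eq_in_count => w; rewrite mem_descendants => /andP[/eqP sw vw].
  by rewrite sw addnK -(eq_class_words vw).
Qed.

(** The fibres of [parent] all have [m ^ N] members, and [child u] enumerates
    the one over [u]. *)
Lemma regular_tree : exists (parent : word m -> word m)
    (child : word m -> 'I_(m ^ N) -> word m),
  [/\ forall u, injective (child u),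
      forall u i, size (child u i) = size u + N /\ parent (child u i) = u,
      forall n v, size v = n + N -> exists i, v = child (parent v) i,
      forall n v, size v = n + N -> e (take n v) (parent v) &
      forall n v w, size v = n + N -> e v w -> parent v = parent w].
Proof.
have [parent parentP] := regroup.
pose fibre v := [seq w <- descendants N v | parent w == v].
have fibreP u (i : 'I_(m ^ N)) : nth [::] (fibre u) i \in fibre u.
  by have [_ _ sf] := parentP (size u) u; rewrite mem_nth // sf.
exists parent, (fun u i => nth [::] (fibre u) i); split.
- move=> u i j /eqP; have [_ _ sf] := parentP (size u) u.
  rewrite nth_uniq ?sf // => [/eqP/val_inj //|].
  exact/filter_uniq/uniq_descendants.
- move=> u i; have := fibreP u i; rewrite {1}mem_filter mem_descendants.
  by case/and3P => /eqP -> /eqP ->.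
- move=> n v sv; have [pv _ _] := parentP n v.
  have [_ _ sf] := parentP (size (parent v)) (parent v).
  have sp : size (parent v) = n.
    by rewrite -(e_size (pv sv)) size_takel // sv leq_addr.
  have vf : v \in fibre (parent v).
    rewrite mem_filter eqxx mem_descendants sp sv eqxx /=.
    by rewrite (equivalence_sym e_equiv) pv.
  have lt : index v (fibre (parent v)) < m ^ N by rewrite -sf // index_mem.
  by exists (Ordinal lt); rewrite /= nth_index.
- by move=> n v; case: (parentP n v).
- by move=> n v w; case: (parentP n v) => _ /(_ w).
Qed.

End Regrouping.

(** * Components of the augmented tree *)

Section Components.
Context {R : realType} {d m : nat} (S : ifs R d m) (K : set 'cV[R]_d).
Hypothesis K_attractor : self_similar_set S K.

Lemma ifs_map_attractor i x : K x -> K (ifs_map S i x).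
Proof. by case: K_attractor => _ _ KE Kx; rewrite KE; exists i => //; exists x. Qed.

Lemma word_map_attractor u x : K x -> K (word_map S u x).
Proof. by move=> Kx; elim: u => //= i u; apply: ifs_map_attractor. Qed.

Lemma word_map_cat u v x : word_map S (u ++ v) x = word_map S u (word_map S v x).
Proof. exact: foldr_cat. Qed.

Lemma cell_sub_attractor u : cell S K u `<=` K.
Proof. by move=> _ [x Kx <-]; apply: word_map_attractor. Qed.

Lemma cell_take n u : cell S K u `<=` cell S K (take n u).
Proof.
move=> _ [x Kx <-]; exists (word_map S (drop n u) x); first exact: word_map_attractor.
by rewrite -word_map_cat cat_take_drop.
Qed.

Lemma attractor_cell n x : K x -> exists2 u, size u = n & cell S K u x.
Proof.
elim: n x => [|n IH] x Kx; first by exists [::] => //; exists x.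
case: K_attractor => _ _ KE; move: Kx; rewrite {1}KE => -[i _ [y Ky <-]].
by have [u su [z Kz <-]] := IH y Ky; exists (i :: u); [rewrite /= su|exists z].
Qed.

Lemma cell_nonempty u : cell S K u !=set0.
Proof. by case: K_attractor => -[x Kx] _ _; exists (word_map S u x); exists x. Qed.

(** A horizontal edge or a loop: two adjacent words may have a common ancestor,
    and with loops every [hstep] projects to an [hstep] of the level above. *)
Definition hstep (u v : word m) : Prop :=
  size u = size v /\ cell S K u `&` cell S K v !=set0.

Definition hlinked : rel (word m) :=
  fun u v => `[< clos_refl_trans (word m) hstep u v >].

Lemma hstep_sym u v : hstep u v -> hstep v u.
Proof. by case=> suv [x [ux vx]]; split=> //; exists x. Qed.

Lemma hlinked_sym u v : hlinked u v -> hlinked v u.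
Proof.
move/asboolP => uv; apply/asboolP; elim: uv => [x y /hstep_sym|x|x y z _ yx _ zy].
- exact: rt_step.
- exact: rt_refl.
- exact: rt_trans zy yx.
Qed.

Lemma hlinked_equiv : equivalence_rel hlinked.
Proof.
move=> u v w; split=> [|uv]; first exact/asboolP/rt_refl.
apply/idP/idP => /asboolP w'; apply/asboolP; apply: rt_trans w'.
  exact/asboolP/hlinked_sym.
exact/asboolP.
Qed.

Lemma hlinked_size u v : hlinked u v -> size u = size v.
Proof. by move/asboolP; elim=> [x y []|//|x y z _ -> _ ->]. Qed.

Lemma hlinked_take n u v : hlinked u v -> hlinked (take n u) (take n v).
Proof.
move/asboolP => uv; apply/asboolP; elim: uv => [x y [sxy [z [xz yz]]]|x|x y z _ xy _ yz].
- apply: rt_step; split; first by rewrite !size_take sxy.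
  by exists z; split; apply: cell_take.
- exact: rt_refl.
- exact: rt_trans xy yz.
Qed.

Lemma cell_hlinked u v x : size u = size v -> cell S K u x -> cell S K v x ->
  hlinked u v.
Proof. by move=> suv ux vx; apply/asboolP/rt_step; split=> //; exists x. Qed.

Definition component (u : word m) : set (word m) := [set v | hlinked u v].

Lemma component_refl u : component u u.
Proof. exact/(equivalence_refl hlinked_equiv). Qed.

Lemma hconnected_component u : hconnected S K (component u).
Proof.
split; first by exists u; apply: component_refl.
suff path v w : clos_refl_trans _ hstep v w -> component u v ->
    component u w /\ clos_refl_trans (word m)
      (fun x y => [/\ component u x, component u y & hedge S K x y]) v w.
  move=> v w uv uw; apply: (proj2 (path v w _ uv)).
  have : hlinked v w by rewrite -(equivalence_eql hlinked_equiv w uv).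
  by move/asboolP.
elim=> [x y xy ux|x ux|x y z _ IHxy _ IHyz ux].
- have uy : component u y.
    by rewrite /component /= (equivalence_eql hlinked_equiv _ ux); apply/asboolP/rt_step.
  split=> //; have [<-|nxy] := pselect (x = y); first exact: rt_refl.
  by apply: rt_step; case: xy.
- by split=> //; apply: rt_refl.
- have [uy xy] := IHxy ux; have [uz yz] := IHyz uy.
  by split=> //; apply: rt_trans xy yz.
Qed.

Lemma hconnected_sub (T : set (word m)) u :
  hconnected S K T -> T u -> T `<=` component u.
Proof.
move=> [_ Tconn] Tu v Tv; apply/asboolP.
elim: (Tconn _ _ Tu Tv) => [x y [_ _ [_ sxy cxy]]|x|x y z _ xy _ yz].
- exact: rt_step.
- exact: rt_refl.
- exact: rt_trans xy yz.
Qed.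

Lemma hcomponent_component u : hcomponent S K (component u).
Proof.
exists (size u); split=> [v /hlinked_size //||T' _ T'conn sub].
  exact: hconnected_component.
apply/seteqP; split=> //; apply: hconnected_sub => //.
exact/sub/component_refl.
Qed.

Lemma hcomponentE (T : set (word m)) u : hcomponent S K T -> T u -> T = component u.
Proof.
move=> [n [Tn Tconn Tmax]] Tu; symmetry; apply: Tmax.
- by move=> v /hlinked_size /= <-; apply: Tn.
- exact: hconnected_component.
- exact: hconnected_sub.
Qed.

Lemma hequiv_refl (T : set (word m)) : hequiv S K T T.
Proof. by exists id; split=> //; split=> // y; exists y. Qed.

Lemma hclass_self u : hclass S K (component u) (component u).
Proof. by split; [apply: hcomponent_component|apply: hequiv_refl]. Qed.

Definition with_children (T : seq (word m)) : seq (word m) :=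
  T ++ [seq rcons u i | u <- T, i <- enum 'I_m].

Lemma uniq_with_children u : uniq (with_children (class_words hlinked u)).
Proof.
have uT := uniq_class_words hlinked u.
rewrite cat_uniq uT /=; apply/andP; split.
  apply/hasPn => _ /allpairsP[[v i] /= [vT _ ->]]; apply/negP => vT'.
  move: vT vT'; rewrite !(mem_class_words hlinked_size).
  by move=> /hlinked_size su /hlinked_size; rewrite size_rcons su; lia.
apply: allpairs_uniq => //; first exact: enum_uniq.
by move=> [v i] [w j] _ _ /rcons_inj.
Qed.

Lemma size_with_children (T : seq (word m)) :
  size (with_children T) = (size T * m.+1)%N.
Proof. by rewrite size_cat size_allpairs size_enum_ord mulnS. Qed.

Lemma mem_with_children u v :
  (component u `|` children (component u)) v <->
  v \in with_children (class_words hlinked u).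
Proof.
rewrite mem_cat (mem_class_words hlinked_size); split.
  case=> [->//|[w uw [i _ <-]]]; apply/orP; right.
  by apply/allpairsP; exists (w, i); rewrite mem_enum (mem_class_words hlinked_size).
case/orP => [?|/allpairsP[[w i] /= [uw _ ->]]]; [by left|right].
by exists w; [move: uw; rewrite (mem_class_words hlinked_size)|exists i].
Qed.

(** An equivalence of components preserves [#|T| * (m + 1)], the number of
    words of [T] and of their children together. *)
Lemma hequiv_size u v : hequiv S K (component u) (component v) ->
  size (class_words hlinked u) = size (class_words hlinked v).
Proof.
move=> [g [[gfun ginj gsurj] _]].
pose Lu := with_children (class_words hlinked u).
pose Lv := with_children (class_words hlinked v).
suff : size Lu = size Lv.
  by rewrite /Lu /Lv !size_with_children => /eqP; rewrite eqn_pmul2r // => /eqP.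
rewrite -(size_map g); apply/perm_size/uniq_perm.
- rewrite map_inj_in_uniq ?uniq_with_children // => x y xu yu.
  by apply: ginj; rewrite inE; apply/mem_with_children.
- exact: uniq_with_children.
- move=> y; apply/mapP/idP => [[x xu ->]|yv].
    by apply/mem_with_children/gfun/mem_with_children.
  by have [x xu <-] := gsurj y (iffRL (mem_with_children v y) yv); exists x => //;
    apply/mem_with_children.
Qed.

Hypothesis K_primitive : simple_primitive_H S K.

Lemma component_bounded :
  exists M, forall u, (size (class_words hlinked u) <= M)%N.
Proof.
case: K_primitive => _ [kappa [cl [A [[_ _ clsurj] _ _]]]] _.
have /choice [B HB] : forall i, exists b, forall u,
    hclass S K (component u) = cl i -> (size (class_words hlinked u) <= b)%N.
  move=> i; have [[u0 u0i]|no] := pselect (exists u, hclass S K (component u) = cl i);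
    last by exists 0%N => u ui; case: no; exists u.
  exists (size (class_words hlinked u0)) => u ui.
  have := hclass_self u; rewrite ui -u0i => -[_ /hequiv_size ->] //.
exists (\max_i B i)%N => u.
have [|i _ ui] := clsurj (hclass S K (component u)).
  by exists (component u) => //; apply: hcomponent_component.
exact: leq_trans (HB i u (esym ui)) (leq_bigmax i).
Qed.

(** Positive entries suffice: the number of descendants of class [j] is never
    computed, only a path of classes joining [i] to [j] is followed downwards. *)
Lemma incidence_power kappa (cl : 'I_kappa -> set (set (word m)))
    (A : 'M[nat]_kappa) n i j u :
  set_bij [set: 'I_kappa] (hclasses S K) cl -> incidence_matrix S K cl A ->
  (0 < (A ^+ n) i j)%N -> hclass S K (component u) = cl i ->
  exists v, [/\ size v = (size u + n)%N, hclass S K (component v) = cl j &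
                hlinked u (take (size u) v)].
Proof.
move=> clbij Ainc; elim: n i u => [|n IH] i u.
  rewrite expr0 mxE; case: eqVneq => // <- _ ui; exists u.
  by rewrite addn0 take_size; split=> //; apply: component_refl.
rewrite exprS mxE => pos ui.
have [k] : exists k, (0 < A i k * (A ^+ n) k j)%N.
  apply/existsP; apply: contraLR pos; rewrite negb_exists => /forallP no.
  rewrite -leqNgt leqn0; apply/eqP; apply: big1 => k _.
  by have := no k; rewrite -leqNgt leqn0 => /eqP.
rewrite muln_gt0 => /andP[Aik Akj].
have [Z [Zcomp Zsub Zk]] : exists Z, [/\ hcomponent S K Z,
    Z `<=` children (component u) & hclass S K Z = cl k].
  have := Ainc i k _ (hcomponent_component u) ui.
  rewrite card_eq_sym => /card_set_bijP [f [ffun _ _]].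
  by have := ffun 0%N Aik => Zf; exists (f 0%N).
have [w Zw] : Z !=set0 by case: Zcomp => n' [_ [] ].
have ZE := hcomponentE Zcomp Zw; rewrite ZE in Zk.
have [w' uw' [a _ w'a]] := Zsub w Zw.
have [v [sv vj wv]] := IH k w Akj Zk.
have sw : size w = (size u).+1 by rewrite -w'a size_rcons (hlinked_size uw').
exists v; split=> //; first by rewrite sv sw addSnnS.
have := hlinked_take (size u) wv; rewrite take_takel ?sw //.
suff -> : take (size u) w = w' by rewrite -(equivalence_eql hlinked_equiv _ uw').
by rewrite -w'a (hlinked_size uw') -cats1 take_size_cat.
Qed.

Lemma component_root v : component [::] v -> v = [::].
Proof. by move/hlinked_size/esym/size0nil. Qed.

(** The root component is a singleton, so every component of its class is. *)
Lemma singleton_descendant : exists n, forall u, exists v,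
  [/\ size v = (size u + n)%N, forall w, hlinked v w -> w = v &
      hlinked u (take (size u) v)].
Proof.
case: K_primitive => _ [kappa [cl [A [clbij Ainc [n _ An]]]]] _.
have clsurj u : exists i, hclass S K (component u) = cl i.
  have [_ _ surj] := clbij; have [|i _ ui] := surj (hclass S K (component u)).
    by exists (component u) => //; apply: hcomponent_component.
  by exists i.
exists n => u; have [i ui] := clsurj u; have [j oj] := clsurj [::].
have [v [sv vj uv]] := incidence_power clbij Ainc (An i j) ui.
exists v; split=> // w vw.
have := hclass_self v; rewrite vj -oj => -[_ /hequiv_size].
have -> : class_words hlinked [::] = [:: [::]].
  apply: perm_small_eq => //; apply: uniq_perm => //; first exact: uniq_class_words.
  move=> x; rewrite (mem_class_words hlinked_size) inE.
  by apply/idP/eqP => [/component_root|->] //; apply: component_refl.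
have : v \in class_words hlinked v.
  by rewrite (mem_class_words hlinked_size); apply: component_refl.
have : w \in class_words hlinked v by rewrite (mem_class_words hlinked_size).
case: (class_words hlinked v) => [//|x [|//]]; rewrite !inE => /eqP -> /eqP -> //.
Qed.

End Components.

(** * Euclidean and sup norms *)

Section Norm.
Context {R : realType} {d : nat}.
Implicit Types x y : 'cV[R]_d.

Lemma enorm0 : enorm (0 : 'cV[R]_d) = 0.
Proof.
by rewrite /enorm big1 ?sqrtr0 // => i _; rewrite mxE expr0n.
Qed.

Lemma enorm_ge0 x : 0 <= enorm x.
Proof. exact: sqrtr_ge0. Qed.

Lemma enorm_sqr x : enorm x ^+ 2 = \sum_i x i 0 ^+ 2.
Proof. by rewrite sqr_sqrtr // sumr_ge0 // => i _; rewrite sqr_ge0. Qed.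

Lemma coord_le_enorm x i : `|x i 0| <= enorm x.
Proof.
rewrite -(@ler_pXn2r _ 2) ?nnegrE ?enorm_ge0 //.
rewrite enorm_sqr real_normK ?num_real // (bigD1 i) //= lerDl.
by apply: sumr_ge0 => j _; rewrite sqr_ge0.
Qed.

(** The library norm [`|x|] is the sup norm; it carries the topology and the
    triangle inequality, and is comparable to [enorm]. *)
Lemma norm_le_enorm x : `|x| <= enorm x.
Proof.
have [->|x0] := eqVneq `|x| 0; first exact: enorm_ge0.
have [[i j] /= xE] := mx_norm_neq0 x0; rewrite [`|x|]xE (ord1 j).
exact: coord_le_enorm.
Qed.

Lemma enorm_le_norm x : enorm x <= d%:R * `|x|.
Proof.
rewrite -(@ler_pXn2r _ 2) ?nnegrE ?enorm_ge0 ?mulr_ge0 // enorm_sqr exprMn.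
have coord i : x i 0 ^+ 2 <= `|x| ^+ 2.
  rewrite -[x i 0 ^+ 2]real_normK ?num_real // ler_pXn2r ?nnegrE //.
  rewrite [`|x|]mx_normrE; exact: (le_bigmax _ (fun ij => `|x ij.1 ij.2|) (i, 0)).
apply: le_trans (ler_sum _ (fun i _ => coord i)) _.
rewrite sumr_const card_ord -[leLHS]mulr_natl ler_wpM2r ?sqr_ge0 //.
by rewrite -natrX ler_nat expnS expn1; case: d => // n; rewrite leq_pmulr.
Qed.

Lemma enormZ (a : R) x : enorm (a *: x) = `|a| * enorm x.
Proof.
rewrite -sqrtr_sqr -sqrtrM ?sqr_ge0 // mulr_sumr; congr Num.sqrt.
by apply: eq_bigr => i _; rewrite mxE exprMn.
Qed.

Lemma enorm_orthogonal (Q : 'M[R]_d) x : Q^T *m Q = 1%:M -> enorm (Q *m x) = enorm x.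
Proof.
have sumE (z : 'cV[R]_d) : \sum_i z i 0 ^+ 2 = (z^T *m z) 0 0 :> R.
  by rewrite mxE; apply: eq_bigr => i _; rewrite mxE expr2.
move=> QQ; rewrite /enorm !sumE trmx_mul -mulmxA (mulmxA Q^T) QQ mul1mx //.
Qed.

End Norm.

(** * Codings by sequences *)

Section Coding.
Context {R : realType}.

(** A bi-Lipschitz identification of [K] with the ultrametric space of sequences
    over [q] letters, [rho ^+ k] being the distance of two sequences that first
    differ at index [k]. *)
Definition coding d (K : set 'cV[R]_d) (q : nat) (rho : R)
    (phi : (nat -> 'I_q) -> 'cV[R]_d) : Prop :=
  set_bij [set: nat -> 'I_q] K phi /\
  exists2 C : R, 0 < C & forall (a b : nat -> 'I_q) k,
    ((forall i, (i < k)%N -> a i = b i) -> enorm (phi a - phi b) <= C * rho ^+ k) /\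
    (a k <> b k -> C^-1 * rho ^+ k <= enorm (phi a - phi b)).

Lemma first_difference (T : eqType) (a b : nat -> T) : a <> b ->
  exists k, a k <> b k /\ forall i, (i < k)%N -> a i = b i.
Proof.
move=> ab; have ex : exists k, a k != b k.
  have [//|no] := pselect (exists k, a k != b k); case: ab; apply/funext => k.
  by apply/eqP; apply: contra_notT no => ?; exists k.
have [k abk kmin] := ex_minnP ex; exists k; split=> [|i ik]; first exact/eqP.
by apply/eqP; apply: contraLR ik => /kmin; rewrite -leqNgt.
Qed.

Lemma coding_lipschitz_equivalent d d' (K : set 'cV[R]_d) (K' : set 'cV[R]_d')
 q rho
    (phi : (nat -> 'I_q) -> 'cV[R]_d) (phi' : (nat -> 'I_q) -> 'cV[R]_d') :
  coding K rho phi -> coding K' rho phi' -> lipschitz_equivalent K K'.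
Proof.
move=> [[pK pinj psurj] [C C0 pC]] [[pK' pinj' psurj'] [C' C'0 pC']].
have [sigma sE] : {sigma : 'cV[R]_d -> 'cV[R]_d' &
    forall x a, phi a = x -> sigma x = phi' a}.
  apply: (@choice _ _ (fun x y => forall a, phi a = x -> y = phi' a)) => x.
  have [[a ax]|no] := pselect (exists a, phi a = x); last first.
    by exists 0 => a ax; case: no; exists a.
  exists (phi' a) => b bx; congr phi'.
  by apply: pinj; rewrite ?inE // ax bx.
exists sigma; split; first split.
- by move=> x /psurj [a _ ax]; rewrite (sE x a ax); apply: pK'.
- move=> x y; rewrite !inE => /psurj [a _ ax] /psurj [b _ bx].
  by rewrite (sE x a ax) (sE y b bx) -ax -bx => /pinj' ->; rewrite ?inE.
- move=> y /psurj' [a _ ay]; exists (phi a); first exact: pK.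
  by rewrite (sE _ a erefl).
exists (C * C'); first exact: mulr_gt0.
move=> x y /psurj [a _ ax] /psurj [b _ bx]; rewrite (sE x a ax) (sE y b bx) -ax -bx.
have [->|ab] := pselect (a = b); first by rewrite !subrr !enorm0 !mulr0 lexx.
have [k [abk abi]] := first_difference ab.
have [/(_ abi) up /(_ abk) lo] := pC a b k.
have [/(_ abi) up' /(_ abk) lo'] := pC' a b k.
rewrite ler_pdivrMl // in lo; rewrite ler_pdivrMl // in lo'.
rewrite ler_pdivrMl ?mulr_gt0 //; apply/andP; split.
  by apply: le_trans up _; rewrite -mulrA ler_pM2l.
by apply: le_trans up' _; rewrite (mulrC C) -mulrA ler_pM2l.
Qed.

End Coding.

Lemma expr_eventually_lt (R : realType) (r eps : R) : 0 < r -> r < 1 -> 0 < eps ->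
  exists k, forall n, (k <= n)%N -> r ^+ n < eps.
Proof.
move=> r0 r1 eps0; have : `|r| < 1 by rewrite gtr0_norm.
move/cvg_expr/cvgrPdist_lt => /(_ eps eps0) [k _ small]; exists k => n kn.
by have := small n kn; rewrite /= sub0r normrN gtr0_norm // exprn_gt0.
Qed.

(** * The coding of an attractor *)

Section AttractorCoding.
Context {R : realType} {d m : nat} (S : ifs R d m) (K : set 'cV[R]_d).
Hypothesis K_attractor : self_similar_set S K.
Local Notation r := (ifs_ratio S).
Local Notation hlinked := (hlinked S K).

Let r_gt0 : 0 < r. Proof. by case/andP: (ifs_ratio_bounds S). Qed.
Let r_lt1 : r < 1. Proof. by case/andP: (ifs_ratio_bounds S). Qed.

Lemma word_map_dist u x y :
  enorm (word_map S u x - word_map S u y) = r ^+ size u * enorm (x - y).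
Proof.
elim: u => [|i u IH] /=; first by rewrite mul1r.
rewrite /ifs_map opprD addrACA subrr addr0 -scalerBr -mulmxBr enormZ.
by rewrite (enorm_orthogonal _ (ifs_rot_orthogonal S i)) IH gtr0_norm // exprS mulrA.
Qed.

Lemma cell_diameter : exists2 D : R, 0 < D & forall u x y,
  cell S K u x -> cell S K u y -> `|x - y| <= D * r ^+ size u.
Proof.
have [_ /compact_bounded [B [_ KB]] _] := K_attractor.
have {KB} KB x : K x -> `|x| <= `|B| + 1.
  by apply: KB; rewrite (le_lt_trans (ler_norm B)) // ltrDl.
have B1 : 0 < `|B| + 1 by rewrite ltr_wpDl.
exists ((d.+1)%:R * (`|B| + 1 + (`|B| + 1))).
  by apply: mulr_gt0; [rewrite ltr0n|apply: addr_gt0].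
move=> u _ _ [x Kx <-] [y Ky <-]; apply: le_trans (norm_le_enorm _) _.
rewrite word_map_dist mulrC ler_pM2r ?exprn_gt0 //.
apply: le_trans (enorm_le_norm _) _; apply: ler_pM => //; first by rewrite ler_nat.
by apply: le_trans (ler_normB _ _) _; apply: lerD; apply: KB.
Qed.

Lemma hlinked_path u v : hlinked u v ->
  exists2 p, path (fun x y => `[< hstep S K x y >]) u p & last u p = v.
Proof.
move/asboolP; elim=> [x y xy|x|x y z _ [p xp <-] _ [q yq <-]].
- by exists [:: y]; rewrite //= andbT; apply/asboolP.
- by exists [::].
- by exists (p ++ q); rewrite ?last_cat // cat_path xp.
Qed.

(** A path of meeting cells that visits no word twice has at most [M] words, and
    the diameters of its cells add up. *)
Lemma component_diameter M :
  (forall u, size (class_words hlinked u) <= M)%N ->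
  exists2 D : R, 0 < D & forall u v x y, hlinked u v ->
    cell S K u x -> cell S K v y -> `|x - y| <= D * r ^+ size u.
Proof.
move=> leM; have [D D0 cellD] := cell_diameter.
exists (M.+1%:R * D); first by rewrite mulr_gt0 ?ltr0n.
move=> u v x y /hlinked_path [p0 up0 <-].
case/shortenP: up0 => p up uniqp _ ux py.
have link w q : path (fun x y => `[< hstep S K x y >]) w q ->
    forall z, z \in w :: q -> hlinked w z.
  elim: q w => [|w' q IH] w /=.
    by move=> _ z; rewrite inE => /eqP ->; apply: component_refl.
  move=> /andP[/asboolP ww' w'q] z; rewrite inE => /orP[/eqP ->|zq].
    exact: component_refl.
  have lww' : hlinked w w' by apply/asboolP/rt_step.
  by rewrite (equivalence_eql (hlinked_equiv S K) _ lww'); apply: IH.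
have sizep : (size (u :: p) <= M)%N.
  apply: leq_trans (leM u); apply: uniq_leq_size => // z zp.
  by rewrite (mem_class_words (@hlinked_size _ _ _ S K)); apply: link zp.
have chain q w z : path (fun x y => `[< hstep S K x y >]) w q -> cell S K w z ->
    cell S K (last w q) y -> `|z - y| <= (size q).+1%:R * D * r ^+ size w.
  elim: q w z => [|w' q IH] w z /=; first by move=> _ wz wy; rewrite mul1r cellD.
  case/andP => /asboolP [sw [t [wt w't]]] w'q wz qy.
  rewrite -(subrKA t) -[(size q).+2]add1n natrD !mulrDl mul1r.
  by apply: le_trans (ler_normD _ _) _; apply: lerD; [apply: cellD|rewrite sw; apply: IH].
apply: le_trans (chain p u x up ux py) _.
by rewrite ler_pM2r ?exprn_gt0 // ler_pM2r // ler_nat ltnW.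
Qed.

Lemma component_separation : condition_H S K ->
  exists2 c : R, 0 < c & forall u v x y, size u = size v -> ~~ hlinked u v ->
    cell S K u x -> cell S K v y -> c * r ^+ size u <= enorm (x - y).
Proof.
case=> c c0 cP; exists c => // u v x y suv nuv ux vy.
have s0 : (0 < size u)%N.
  rewrite lt0n; apply: contra nuv => /eqP su; have := suv; rewrite su => /esym sv.
  by rewrite (size0nil su) (size0nil sv); apply: component_refl.
have disj : cell S K u `&` cell S K v = set0.
  apply/seteqP; split=> // z [uz vz]; move/negP: nuv; apply.
  exact: cell_hlinked uz vz.
apply: le_trans (cP _ u v s0 erefl (esym suv) disj) _.
apply: ge_inf; last by exists x => //; exists y.
by exists 0 => _ [z _ [t _ <-]]; apply: enorm_ge0.
Qed.

Lemma alphabet_gt0 : (0 < m)%N.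
Proof.
case: K_attractor => -[x Kx] _ KE; move: Kx; rewrite KE => -[[i im] _ _].
exact: leq_ltn_trans im.
Qed.

(** For [m = 1] the powers of [m] do not grow, but then every level has a
    single word and [M = 1] is a bound. *)
Lemma component_bounded_power :
  simple_primitive_H S K -> exists M N0 : nat,
    (forall u, size (class_words hlinked u) <= M)%N /\
    forall N, (N0 <= N)%N -> (M * M <= m ^ N)%N.
Proof.
move=> Kprim; have [M0 leM0] := component_bounded Kprim.
have m0 := alphabet_gt0; have [m1|m1] := leqP m 1%N.
  have {m1 m0} m1 : m = 1%N by apply/eqP; rewrite eqn_leq m1.
  have pow n : (m ^ n)%N = 1%N by rewrite m1 exp1n.
  exists 1%N, 0%N; split=> [u|N _]; last by rewrite pow.
  rewrite size_filter; apply: leq_trans (count_size _ _) _.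
  by rewrite size_words pow.
exists M0, (M0 * M0)%N; split=> // N leN; apply: leq_trans leN _.
exact/ltnW/ltn_expl.
Qed.

Section Branches.
Variables (N : nat) (parent : word m -> word m) (child : word m -> 'I_(m ^ N) -> word m).
Hypotheses (child_inj : forall u, injective (child u))
  (childP : forall u i, size (child u i) = (size u + N)%N /\ parent (child u i) = u)
  (parent_take : forall n v, size v = (n + N)%N -> hlinked (take n v) (parent v))
  (parent_eq : forall n v w, size v = (n + N)%N -> hlinked v w -> parent v = parent w).

Fixpoint branch (a : nat -> 'I_(m ^ N)) (k : nat) : word m :=
  if k is k'.+1 then child (branch a k') (a k') else [::].

Definition in_component (u : word m) (x : 'cV[R]_d) : Prop :=
  exists2 v, hlinked u v & cell S K v x.

Lemma size_branch a k : size (branch a k) = (k * N)%N.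
Proof. by elim: k => //= k IH; rewrite (childP _ _).1 IH mulSn addnC. Qed.

Lemma eq_branch a b k : (forall i, (i < k)%N -> a i = b i) -> branch a k = branch b k.
Proof.
elim: k => //= k IH ab; rewrite IH => [|i ik]; first by rewrite ab.
by apply: ab; apply: ltnW.
Qed.

Lemma hlinked_branch a b k : hlinked (branch a k.+1) (branch b k.+1) ->
  branch a k = branch b k.
Proof.
move=> /= ab; rewrite -[LHS](childP _ (a k)).2 -[RHS](childP _ (b k)).2.
by apply: (parent_eq (n := k * N)%N) ab; rewrite (childP _ _).1 size_branch.
Qed.

Lemma branch_inj a b k : branch a k.+1 = branch b k.+1 -> a k = b k.
Proof.
move=> ab; have abk : branch a k = branch b k.
  by apply: hlinked_branch; rewrite ab; apply: component_refl.
by move: ab; rewrite /= abk => /child_inj.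
Qed.

(** The components met by a branch are nested, although its words need not
    extend each other. *)
Lemma branch_take a k j : hlinked (branch a k) (take (k * N) (branch a (k + j)%N)).
Proof.
elim: j => [|j IH].
  by rewrite addn0 take_oversize ?size_branch //; apply: component_refl.
rewrite (equivalence_eql (hlinked_equiv S K) _ IH) addnS.
have s : size (branch a (k + j).+1) = ((k + j) * N + N)%N.
  by rewrite size_branch mulSn addnC.
have := parent_take s; rewrite (equivalence_sym (hlinked_equiv S K)) /= (childP _ _).2.
move/(hlinked_take K_attractor (k * N)); rewrite take_takel //.
by rewrite leq_mul2r leq_addr orbT.
Qed.

Lemma in_component_eq u v x : size u = size v -> in_component u x ->
  in_component v x -> hlinked u v.
Proof.
move=> suv [u' uu' u'x] [v' vv' v'x].
rewrite (equivalence_eql (hlinked_equiv S K) _ uu').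
rewrite (equivalence_sym (hlinked_equiv S K)).
rewrite (equivalence_eql (hlinked_equiv S K) _ vv').
by apply: cell_hlinked v'x u'x; rewrite -(hlinked_size uu') -(hlinked_size vv').
Qed.

(** Separation replaces closedness of the components: a cluster point of the
    chosen points of the cells cannot leave the component at any level. *)
Lemma branch_point c a : 0 < c ->
  (forall u v x y, size u = size v -> ~~ hlinked u v ->
    cell S K u x -> cell S K v y -> c * r ^+ size u <= enorm (x - y)) ->
  exists x, K x /\ forall k, in_component (branch a k) x.
Proof.
move=> c0 sep.
have [x xP] : {x : nat -> 'cV[R]_d & forall k, cell S K (branch a k) (x k)}.
  by apply: (@choice _ _ (fun k => cell S K (branch a k))) => k; apply: cell_nonempty.
have [_ Kcomp _] := K_attractor.
have [|p [Kp pcl]] := Kcomp (x @ \oo) _.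
  by exists 0%N => // k _; apply: (cell_sub_attractor K_attractor (xP k)).
exists p; split=> // k.
have [u su up] := attractor_cell K_attractor (k * N) Kp.
exists u => //; have [//|nlink] := boolP (hlinked (branch a k) u).
have e0 : 0 < c * r ^+ (k * N) / (d.+1)%:R.
  by rewrite divr_gt0 ?mulr_gt0 ?exprn_gt0 ?ltr0n.
have tail : (x @ \oo) [set x j | j in [set j | (k <= j)%N]].
  by exists k => // j kj; exists j.
have [_ [[j kj <-]]] := pcl _ _ tail (nbhsx_ballx p _ e0).
rewrite mx_norm_ball /ball_ /= ltr_pdivlMr // => small.
have xj : cell S K (take (k * N) (branch a j)) (x j).
  exact: (cell_take K_attractor _ (xP j)).
have kj' : hlinked (branch a k) (take (k * N) (branch a j)).
  by have := branch_take a k (j - k); rewrite subnKC.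
have su' : size u = size (take (k * N) (branch a j)).
  by rewrite -(hlinked_size kj') size_branch.
have nlink' : ~~ hlinked u (take (k * N) (branch a j)).
  apply: contra nlink; rewrite (equivalence_sym (hlinked_equiv S K)).
  by rewrite (equivalence_eql (hlinked_equiv S K) _ kj').
have := sep _ _ _ _ su' nlink' up xj; rewrite su leNgt => /negP; case.
apply: le_lt_trans (enorm_le_norm _) (le_lt_trans _ small).
by rewrite mulrC ler_wpM2l // ler_nat.
Qed.

End Branches.

(** Sequences that agree below [k] have the same branch word at level [k], so
    their points share a component there. Sequences that differ at [k] have
    unlinked branch words from index [k + 2] on: linked words have a common
    parent, and siblings are told apart by their letter. *)
Theorem attractor_coding : simple_primitive_H S K ->
  exists N0, forall N, (N0 <= N)%N ->
    exists phi : (nat -> 'I_(m ^ N)) -> 'cV[R]_d, coding K (r ^+ N) phi.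
Proof.
move=> Kprim; have [M [N1 [leM leMN]]] := component_bounded_power Kprim.
have [n0 single] := singleton_descendant K_attractor Kprim.
have [D D0 diam] := component_diameter leM.
have [c c0 sep] : exists2 c : R, 0 < c & forall u v x y, size u = size v ->
    ~~ hlinked u v -> cell S K u x -> cell S K v y -> c * r ^+ size u <= enorm (x - y).
  by apply: component_separation; case: Kprim.
(* The successor makes [N] positive, so that [r ^+ N < 1] even when [m = 1]. *)
exists (N1 + n0).+1 => N leN.
have [N' leN' [NE N_gt0]] : exists2 N', (N1 <= N')%N & N = (N' + n0)%N /\ (0 < N)%N.
  by exists (N - n0)%N; lia.
have [parent [child [inj childP surj ptake peq]]] :=
  regular_tree (hlinked_equiv S K) (@hlinked_size _ _ _ S K)
    (hlinked_take K_attractor) leM single (leMN _ leN').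
move: parent child inj childP surj ptake peq; rewrite -NE {N' NE leN' leN}.
move=> parent child inj childP surj ptake peq.
have /choice [phi phiP] := fun a => branch_point childP ptake a c0 sep.
have phi_close a x k : in_component (branch child a k) x ->
    `|phi a - x| <= D * (r ^+ N) ^+ k.
  move=> [v av vx]; have [w aw wx] := (phiP a).2 k.
  rewrite -exprM mulnC -(size_branch childP a k) (hlinked_size aw).
  apply: diam wx vx; rewrite -(equivalence_eql (hlinked_equiv S K) _ aw) //.
have phi_eq a b k : phi a = phi b -> a k = b k.
  move=> ab; apply: (branch_inj inj childP peq); apply: (hlinked_branch childP peq).
  apply: (in_component_eq (x := phi a)); last by rewrite ab; apply: (phiP b).2.
    by rewrite !(size_branch childP).
  exact: (phiP a).2.
exists phi; split; first split.
- by move=> a _; case: (phiP a).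
- by move=> a b _ _ ab; apply/funext => k; apply: phi_eq.
- move=> x Kx.
  have [u uP] : {u : nat -> word m &
      forall k, size (u k) = (k * N)%N /\ cell S K (u k) x}.
    apply: (@choice _ _ (fun k v => size v = (k * N)%N /\ cell S K v x)) => k.
    by have [v] := attractor_cell K_attractor (k * N) Kx; exists v.
  have su k : size (u k.+1) = (k * N + N)%N by rewrite (uP _).1 mulSn addnC.
  (* The words [u k] of the cells around [x] need not form a branch, but their
     parents do, because linked words have the same parent. *)
  pose p k := parent (u k.+1).
  have pu k : hlinked (u k) (p k).
    have utake : hlinked (u k) (take (k * N) (u k.+1)).
      apply: cell_hlinked (uP k).2 (cell_take K_attractor _ (uP k.+1).2).
      by rewrite (uP k).1 size_takel // su leq_addr.
    by rewrite (equivalence_eql (hlinked_equiv S K) _ utake); apply: ptake (su k).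
  have [a aP] : {a : nat -> 'I_(m ^ N) & forall k, p k.+1 = child (p k) (a k)}.
    apply: (@choice _ _ (fun k i => p k.+1 = child (p k) i)) => k.
    have sp : size (p k.+1) = (k * N + N)%N by rewrite -su (hlinked_size (pu k.+1)).
    have [i pi] := surj _ _ sp; exists i; rewrite {1}pi; congr (child _ i).
    by symmetry; apply: peq (su k) (pu k.+1).
  have branchE k : branch child a k = p k.
    elim: k => [|k IH] /=; last by rewrite aP IH.
    by apply/esym/size0nil; rewrite -(hlinked_size (pu 0%N)) (uP 0%N).1.
  have xa k : in_component (branch child a k) x.
    exists (u k); last exact: (uP k).2.
    by rewrite branchE (equivalence_sym (hlinked_equiv S K)).
  exists a => //; apply/eqP; rewrite -subr_eq0 -normr_eq0; apply/negP => /negP neq.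
  have pos : 0 < `|phi a - x| / D by rewrite divr_gt0 // lt_def neq normr_ge0.
  have rN1 : r ^+ N < 1 by rewrite exprn_ilt1 ?ltW //; case: (N) N_gt0.
  have [k /(_ k (leqnn k))] := expr_eventually_lt (exprn_gt0 N r_gt0) rN1 pos.
  by rewrite ltr_pdivlMr // mulrC ltNge (phi_close a x k (xa k)).
have rN0 : 0 < r ^+ N by rewrite exprn_gt0.
(* The exponent 2 is the delay between a differing letter and the separation
   of the components. *)
pose lo := c * (r ^+ N) ^+ 2; pose up := d.+1%:R * D.
have lo0 : 0 < lo by rewrite mulr_gt0 ?exprn_gt0.
have up0 : 0 < up by rewrite mulr_gt0 ?ltr0n.
exists (up + lo^-1); first by rewrite addr_gt0 ?invr_gt0.
move=> a b k; split=> [ab|abk].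
  have : in_component (branch child a k) (phi b).
    by rewrite (eq_branch child ab); apply: (phiP b).2.
  move=> /phi_close close; apply: le_trans (enorm_le_norm _) _.
  apply: (@le_trans _ _ (up * (r ^+ N) ^+ k)); last first.
    by rewrite ler_pM2r ?exprn_gt0 // lerDl invr_ge0 ltW.
  by rewrite /up -mulrA ler_pM // ?ler_nat // mulr_ge0.
have [v av vx] := (phiP a).2 k.+2; have [w bw wx] := (phiP b).2 k.+2.
have nvw : ~~ hlinked v w.
  apply/negP => vw; case: abk; apply: (branch_inj inj childP peq).
  apply: (hlinked_branch childP peq).
  rewrite (equivalence_eql (hlinked_equiv S K) _ av).
  rewrite (equivalence_eql (hlinked_equiv S K) _ vw).
  by rewrite (equivalence_sym (hlinked_equiv S K)).
have svw : size v = size w.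
  by rewrite -(hlinked_size av) -(hlinked_size bw) !(size_branch childP).
apply: le_trans (sep _ _ _ _ svw nvw vx wx).
rewrite -(hlinked_size av) (size_branch childP) mulnC exprM -addn2 exprD.
rewrite (mulrC (_ ^+ k)) mulrA ler_pM2r ?exprn_gt0 // -/lo.
by rewrite -[leRHS]invrK lef_pV2 ?posrE ?addr_gt0 ?invr_gt0 // lerDr ltW.
Qed.

End AttractorCoding.

(** * A dust-like model with a small ratio *)

Section Compactness.
Context {R : realType} {d d' : nat}.

Lemma lipschitz_equivalent_compact (K : set 'cV[R]_d) (K' : set 'cV[R]_d') :
  lipschitz_equivalent K K' -> compact K -> compact K'.
Proof.
move=> [sigma [[sK _ sK'] [C C0 lip]]] Kc.
have -> : K' = sigma @` K.
  by apply/seteqP; split=> [y /sK' //|_ [x Kx <-]]; apply: sK.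
apply: continuous_compact Kc; apply/subspace_continuousP => x Kx.
apply/cvgrPdist_lt => eps eps0.
have e0 : 0 < eps / (C * d.+1%:R) by rewrite divr_gt0 ?mulr_gt0 ?ltr0n.
apply: filterS (nbhsx_ballx x _ e0) => t; rewrite mx_norm_ball /ball_ /= => bt Kt.
apply: le_lt_trans (norm_le_enorm _) _.
have /andP[_ up] := lip x t Kx Kt; apply: le_lt_trans up _; move: bt.
rewrite ltr_pdivlMr ?mulr_gt0 ?ltr0n //; apply: le_lt_trans.
rewrite mulrCA ler_pM2l // mulrC; apply: le_trans (enorm_le_norm _) _.
by rewrite ler_wpM2r // ler_nat.
Qed.

End Compactness.

Section DustLike.
Context {R : realType} (rho : R).
Hypotheses (rho_gt0 : 0 < rho) (rho_small : rho <= 3^-1).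

Let digit_sum (s : nat -> bool) (n : nat) : R := \sum_(0 <= k < n) rho ^+ k *+ s k.

Let digit_sumS s n :
  digit_sum s n.+1 = (s 0%N)%:R + rho * digit_sum (s \o succn) n.
Proof.
rewrite /digit_sum big_nat_recl // expr0 mulr_sumr; congr (_ + _).
by apply: eq_bigr => k _; rewrite exprS mulrnAr.
Qed.

Let digit_sum_bounds s n : 0 <= digit_sum s n <= 3 / 2.
Proof.
elim: n s => [|n IH] s; first by rewrite /digit_sum big_nil lexx divr_ge0.
rewrite digit_sumS; have /andP[lo up] := IH (s \o succn).
have := ler_wpM2r lo rho_small; have := mulr_ge0 (ltW rho_gt0) lo.
by case: (s 0%N) => /= *; apply/andP; split; lra.
Qed.

Let digit_sum_cvg s : cvgn (digit_sum s).
Proof.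
apply: nondecreasing_is_cvgn; last first.
  by exists (3 / 2) => _ [n _ <-]; case/andP: (digit_sum_bounds s n).
apply/nondecreasing_seqP => n; rewrite /digit_sum big_nat_recr //= lerDl.
by rewrite mulrn_wge0 // exprn_ge0 // ltW.
Qed.

Definition digit_series (s : nat -> bool) : R := limn (digit_sum s).

Lemma digit_series_bounds s : 0 <= digit_series s <= 3 / 2.
Proof.
apply/andP; split.
  apply: limr_ge; first exact: digit_sum_cvg.
  by apply: nearW => n; case/andP: (digit_sum_bounds s n).
apply: limr_le; first exact: digit_sum_cvg.
by apply: nearW => n; case/andP: (digit_sum_bounds s n).
Qed.

Lemma digit_seriesS s :
  digit_series s = (s 0%N)%:R + rho * digit_series (s \o succn).
Proof.
apply/cvg_lim => //; rewrite -(cvg_shiftS (digit_sum s)) /=.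
under eq_fun do rewrite digit_sumS.
by apply: cvgD; [apply: cvg_cst|apply: cvgMr; apply: digit_sum_cvg].
Qed.

Context {q : nat}.

Lemma corner_ratio_bounds : 0 < rho < 1.
Proof. by rewrite rho_gt0 (le_lt_trans rho_small) // invf_lt1 // ltr1n. Qed.

Lemma id_orthogonal (i : 'I_q) : (1%:M : 'M[R]_q)^T *m 1%:M = 1%:M.
Proof. by rewrite trmx1 mul1mx. Qed.

(** The homotheties [x |-> rho x + e_i], which shrink towards the corners of a
    simplex: the [i]-th coordinate is at least 1 on the [i]-th copy of the
    attractor and at most 1/2 on the others. *)
Definition corner_ifs : ifs R q q :=
  @IFS R q q rho (fun=> 1%:M) (fun i => delta_mx i 0) corner_ratio_bounds
    id_orthogonal.

(** The sum of the series [\sum_k rho ^ k e_(a k)], coordinate by coordinate. *)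
Definition corner_point (a : nat -> 'I_q) : 'cV[R]_q :=
  \col_i digit_series (fun k => a k == i).

Lemma corner_mapE i x j : ifs_map corner_ifs i x j 0 = (i == j)%:R + rho * x j 0.
Proof. by rewrite /ifs_map /= mul1mx !mxE eqxx andbT addrC eq_sym. Qed.

Lemma corner_pointS a :
  corner_point a = ifs_map corner_ifs (a 0%N) (corner_point (a \o succn)).
Proof.
by apply/matrixP => i j; rewrite (ord1 j) corner_mapE !mxE digit_seriesS.
Qed.

Lemma corner_point_bounds a i : 0 <= corner_point a i 0 <= 3 / 2.
Proof. by rewrite mxE; apply: digit_series_bounds. Qed.

Lemma corner_map_separated (a b : nat -> 'I_q) i j : i != j ->
  2^-1 <= enorm (ifs_map corner_ifs i (corner_point a) -
                 ifs_map corner_ifs j (corner_point b)).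
Proof.
move=> ij; apply: le_trans (coord_le_enorm _ i); apply: le_trans (ler_norm _).
rewrite mxE [X in _ <= _ + X]mxE !corner_mapE eqxx eq_sym (negbTE ij).
have /andP[a0 _] := corner_point_bounds a i.
have /andP[b0 b1] := corner_point_bounds b i.
have := ler_wpM2r b0 rho_small; have := mulr_ge0 (ltW rho_gt0) a0.
by move=> *; rewrite /=; lra.
Qed.

Lemma corner_map_dist i x y :
  enorm (ifs_map corner_ifs i x - ifs_map corner_ifs i y) = rho * enorm (x - y).
Proof.
rewrite /ifs_map opprD addrACA subrr addr0 -scalerBr -mulmxBr enormZ /= mul1mx.
by rewrite gtr0_norm.
Qed.

Lemma corner_coding : coding (range corner_point) rho corner_point.
Proof.
have lower k (a b : nat -> 'I_q) : a k <> b k ->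
    2^-1 * rho ^+ k <= enorm (corner_point a - corner_point b).
  elim: k a b => [|k IH] a b abk;
    rewrite (corner_pointS a) (corner_pointS b);
    have [ab|ab] := eqVneq (a 0%N) (b 0%N).
  - by case: abk.
  - by rewrite mulr1; apply: corner_map_separated.
  - by rewrite ab corner_map_dist exprS mulrCA ler_pM2l //; apply: IH.
  - apply: le_trans (corner_map_separated _ _ ab).
    by rewrite ger_pMr ?invr_gt0 // exprn_ile1 ?ltW //; case/andP: corner_ratio_bounds.
have upper k (a b : nat -> 'I_q) : (forall i, (i < k)%N -> a i = b i) ->
    enorm (corner_point a - corner_point b) <= q%:R * (3 / 2) * rho ^+ k.
  elim: k a b => [|k IH] a b ab.
    rewrite mulr1; apply: le_trans (enorm_le_norm _) _; rewrite ler_wpM2l //.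
    have [->|x0] := eqVneq `|corner_point a - corner_point b| 0.
      by rewrite divr_ge0.
    have [[i j] /= xE] := mx_norm_neq0 x0; rewrite [`|_|]xE (ord1 j) mxE [X in _ + X]mxE.
    have /andP[a0 a1] := corner_point_bounds a i.
    have /andP[b0 b1] := corner_point_bounds b i.
    by rewrite ler_norml; apply/andP; split; lra.
  rewrite (corner_pointS a) (corner_pointS b) ab // corner_map_dist exprS mulrCA ler_pM2l //.
  by apply: IH => i ik; apply: ab.
split; first split.
- by move=> a _; exists a.
- move=> a b _ _ ab; apply/funext => k; have [//|/lower] := pselect (a k = b k).
  rewrite ab subrr enorm0 leNgt => /negP; case.
  by rewrite mulr_gt0 ?invr_gt0 ?exprn_gt0.
- by move=> _ [a _ <-]; exists a.
have q0 : 0 <= q%:R * (3 / 2) :> R by rewrite mulr_ge0 ?divr_ge0.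
have C0 : 0 < q%:R * (3 / 2) + 2 :> R by rewrite ltr_wpDl.
exists (q%:R * (3 / 2) + 2) => // a b k.
split=> [/upper le1|/lower]; [apply: le_trans le1 _|apply: le_trans].
  by rewrite ler_pM2r ?exprn_gt0 // lerDl.
by rewrite ler_pM2r ?exprn_gt0 // lef_pV2 ?posrE // lerDr.
Qed.

(** Compactness is left as a premise: it is transported from the given attractor
    along the Lipschitz equivalence. *)
Lemma corner_attractor : (0 < q)%N -> compact (range corner_point) ->
  self_similar_set corner_ifs (range corner_point).
Proof.
move=> q0 cK; split=> //.
  by exists (corner_point (fun=> Ordinal q0)), (fun=> Ordinal q0).
apply/seteqP; split=> [_ [a _ <-]|_ [i _ [_ [a _ <-] <-]]].
  by exists (a 0%N) => //; exists (corner_point (a \o succn));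
    [exists (a \o succn)|rewrite -corner_pointS].
exists (fun k => if k is k'.+1 then a k' else i) => //.
by rewrite corner_pointS.
Qed.

Lemma corner_dust_like : dust_like corner_ifs (range corner_point).
Proof.
move=> i j ij; apply/seteqP; split=> // z [[_ [a _ <-] az] [_ [b _ <-] bz]].
have := corner_map_separated a b ij.
by rewrite az bz subrr enorm0 invr_le0 lern0.
Qed.

End DustLike.

(** * The two equivalences *)

Theorem theorem1p2 (R : realType) :
  (forall (d m : nat) (S : ifs R d m) (K : set 'cV[R]_d),
     self_similar_set S K -> simple_primitive_H S K ->
     exists (d' m' : nat) (S' : ifs R d' m') (K' : set 'cV[R]_d'),
       [/\ self_similar_set S' K', dust_like S' K' &
           lipschitz_equivalent K K'])
  /\
  (forall (d d' m : nat) (S : ifs R d m) (S' : ifs R d' m)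
          (K : set 'cV[R]_d) (K' : set 'cV[R]_d'),
     self_similar_set S K -> simple_primitive_H S K ->
     self_similar_set S' K' -> simple_primitive_H S' K' ->
     ifs_ratio S = ifs_ratio S' ->
     lipschitz_equivalent K K').
Proof.
split=> [d m S K KS Kprim|d d' m S S' K K' KS Kprim KS' Kprim' rE].
  have [N0 cod] := attractor_coding KS Kprim.
  have /andP[r0 r1] := ifs_ratio_bounds S.
  have third : 0 < 3^-1 :> R by rewrite invr_gt0.
  have [N1 small] := expr_eventually_lt r0 r1 third.
  have [phi phiP] := cod _ (leq_maxl N0 N1).
  have {}small := ltW (small _ (leq_maxr N0 N1)).
  have {}r0 := exprn_gt0 (maxn N0 N1) r0.
  set q := (m ^ maxn N0 N1)%N in phi phiP.
  have KK' := coding_lipschitz_equivalent phiP (corner_coding r0 small (q := q)).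
  exists q, q, (corner_ifs r0 small), (range (corner_point (ifs_ratio S ^+ maxn N0 N1))).
  split=> //; last exact: corner_dust_like.
  apply: corner_attractor; first by rewrite expn_gt0 (alphabet_gt0 KS).
  by apply: lipschitz_equivalent_compact KK' _; case: KS.
have [N0 cod] := attractor_coding KS Kprim.
have [N0' cod'] := attractor_coding KS' Kprim'.
have [phi phiP] := cod _ (leq_maxl N0 N0').
have [phi' phiP'] := cod' _ (leq_maxr N0 N0').
by rewrite -rE in phiP'; apply: coding_lipschitz_equivalent phiP phiP'.
Qed.
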